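(* Let $k\ge2$, $0\le\alpha<1$, and let $G$ be a connected $k$-uniform hypergraph with $\alpha$-Perron vector $x$. Let $e,f\in E(G)$ with $e\cap f=\emptyset$, and let $U\subset e$, $V\subset f$ with $1\le|U|=|V|\le k-1$. Let $e'=U\cup(f\setminus V)$ and $f'=V\cup(e\setminus U)$, and suppose $e',f'\notin E(G)$. Let $G'$ be obtained from $G$ by deleting $e,f$ and adding $e',f'$. Writing $x_S=\prod_{w\in S}x_w$ for $S\subseteq V(G)$, if $x_U\ge x_V$ and $x_{e\setminus U}\le x_{f\setminus V}$, with at least one of these two inequalities strict, then $\rho_\alpha(G)<\rho_\alpha(G')$.
   Context: Hypergraphs are finite with edges being sets; $k$-uniform means every edge has $k$ vertices; degrees count edges containing a vertex. $\mathcal A(G)$ is the order-$k$ tensor with $(i_1,\dots,i_k)$-entry $\frac1{(k-1)!}$ if $\{i_1,\dots,i_k\}\in E(G)$, $0$ otherwise; $\mathcal D(G)$ is the diagonal tensor of degrees; $\mathcal A_\alpha(G)=\alpha\mathcal D(G)+(1-\alpha)\mathcal A(G)$. For an order-$k$ tensor $\mathcal T$, $(\mathcal Tx)_i=\sum_{i_2,\dots,i_k}\mathcal T_{ii_2\dots i_k}x_{i_2}\cdots x_{i_k}$; $\lambda$ is an eigenvalue if $\mathcal Tx=\lambda x^{[k-1]}$ for some $x\ne0$. $\rho_\alpha(G)$ is the largest modulus of an eigenvalue of $\mathcal A_\alpha(G)$. Connected: any two vertices joined by a path (alternating sequence of distinct vertices and distinct edges, consecutive vertices lying in the edge between them). For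 connected $G$, the $\alpha$-Perron vector is the unique entrywise positive $x$ with $\sum_i x_i^k=1$ and $\mathcal A_\alpha(G)x=\rho_\alpha(G)x^{[k-1]}$. *)

(* Defs.v *)
From HB Require Import structures.
From mathcomp Require Import all_boot all_order all_algebra.
Set Implicit Arguments. Unset Strict Implicit. Unset Printing Implicit Defensive.
Import Order.TTheory GRing.Theory Num.Theory.
Local Open Scope ring_scope.

(* A hypergraph on vertex set 'I_n is given by its edge set E : {set {set 'I_n}}. *)

Definition uniform (n k : nat) (E : {set {set 'I_n}}) : Prop :=
  forall e, e \in E -> #|e| = k.

Definition deg (n : nat) (E : {set {set 'I_n}}) (i : 'I_n) : nat :=
  #|[set e in E | i \in e]|.

Definition connected (n : nat) (E : {set {set 'I_n}}) : Prop :=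
  forall u v : 'I_n, exists (p : seq 'I_n) (es : seq {set 'I_n}),
    [/\ last u p = v, uniq (u :: p), uniq es, size es = size p &
        all (fun e => e \in E) es] /\
        (forall j, (j < size es)%N ->
          nth u (u :: p) j \in nth set0 es j /\ nth u (u :: p) j.+1 \in nth set0 es j).

(* An order-k tensor of dimension n: entry T i t = T_{i, t 0, ..., t (k-2)}. *)
Definition tensor (C : numClosedFieldType) (n k : nat) :=
  'I_n -> {ffun 'I_k.-1 -> 'I_n} -> C.

Definition tapp (C : numClosedFieldType) (n k : nat) (T : tensor C n k)
  (x : 'I_n -> C) (i : 'I_n) : C :=
  \sum_(t : {ffun 'I_k.-1 -> 'I_n}) T i t * \prod_(j < k.-1) x (t j).

Definition teigenvalue (C : numClosedFieldType) (n k : nat) (T : tensor C n k)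
  (l : C) : Prop :=
  exists x : 'I_n -> C, (exists i, x i != 0) /\
    forall i, tapp T x i = l * x i ^+ k.-1.

Definition is_specrad (C : numClosedFieldType) (n k : nat) (T : tensor C n k)
  (r : C) : Prop :=
  (exists l, teigenvalue T l /\ `|l| = r) /\
  (forall l, teigenvalue T l -> `|l| <= r).

Definition adjT (C : numClosedFieldType) (n k : nat) (E : {set {set 'I_n}})
  : tensor C n k :=
  fun i t => if ([set i] :|: [set t j | j : 'I_k.-1]) \in E
             then (k.-1)`!%:R^-1 else 0.

Definition degT (C : numClosedFieldType) (n k : nat) (E : {set {set 'I_n}})
  : tensor C n k :=
  fun i t => if t == [ffun=> i] then (deg E i)%:R else 0.

Definition AalphaT (C : numClosedFieldType) (n k : nat) (a : C)
  (E : {set {set 'I_n}}) : tensor C n k :=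
  fun i t => a * @degT C n k E i t + (1 - a) * @adjT C n k E i t.

Definition xprod (C : numClosedFieldType) (n : nat) (x : 'I_n -> C)
  (S : {set 'I_n}) : C := \prod_(w in S) x w.

(* Main.v *)
Require Import Defs.
From HB Require Import structures.
From mathcomp Require Import all_boot all_order all_algebra ring lra.
From mathcomp Require Import polyrcf.
From mathcomp Require ordered_qelim qe_rcf.
Set Implicit Arguments. Unset Strict Implicit. Unset Printing Implicit Defensive.
Import Order.TTheory GRing.Theory Num.Theory.
Local Open Scope ring_scope.

(** On vectors [y >= 0] with [\sum_i y i ^+ k = 1], let
    [Q_E y = \sum_i y i * (A_alpha(E) y) i].  A maximizer of [Q_E'] is an
    eigenvector of [A_alpha(E')] with eigenvalue [mu = max Q_E'], so
    [mu <= rho'], while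
    [Q_E' x - Q_E x = (1 - a) k (x_U - x_V) (x_(f - V) - x_(e - U)) >= 0]
    gives [rho = Q_E x <= Q_E' x <= mu].  If [rho' <= rho], then [x] itself
    maximizes [Q_E'], hence solves both eigenvalue equations; comparing them at
    a vertex of [U] and at a vertex of [e - U] yields [x_U = x_V] and
    [x_(e - U) = x_(f - V)].

    [C] is an arbitrary algebraically closed field with norm, so its real
    elements need not be complete and compactness is not available.  They
    form a real closed field; quantifier elimination gives suprema of
    definable sets, and these suffice for the existence of a maximizer. *)

(** * The real elements of [C] as a real closed field *)

Section RealElements.
Variable C : numClosedFieldType.

Record realpart := RealPart { cval : C; cvalP : cval \is Num.real }.

HB.instance Definition _ := [isSub for cval].
HB.instance Definition _ := [Choice of realpart by <:].
HB.instance Definition _ := [SubChoice_isSubIntegralDomain of realpart by <:].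
HB.instance Definition _ := [SubIntegralDomain_isSubField of realpart by <:].

Let ler (x y : realpart) := cval x <= cval y.
Let ltr (x y : realpart) := cval x < cval y.
Let normr (x : realpart) : realpart := RealPart (normr_real (cval x)).

Let ler0D x y : ler 0 x -> ler 0 y -> ler 0 (x + y).
Proof. exact: addr_ge0. Qed.
Let ler0M x y : ler 0 x -> ler 0 y -> ler 0 (x * y).
Proof. exact: mulr_ge0. Qed.
Let ler0_anti x : ler 0 x -> ler x 0 -> x = 0.
Proof. by move=> x0 x1; apply/val_inj/le_anti/andP; split. Qed.
Let lerB0 x y : ler 0 (y - x) = ler x y.
Proof. exact: subr_ge0. Qed.
Let ler0_total x : ler 0 x || ler x 0.
Proof. exact: cvalP x. Qed.
Let normrN x : normr (- x) = normr x.
Proof. exact/val_inj/normrN. Qed.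
Let ger0_norm x : ler 0 x -> normr x = x.
Proof. by move=> x0; apply/val_inj/ger0_norm. Qed.
Let ltr_def x y : ltr x y = (y != x) && ler x y.
Proof. exact: lt_def. Qed.

HB.instance Definition _ := Num.IntegralDomain_isLeReal.Build realpart
  ler0D ler0M ler0_anti lerB0 ler0_total normrN ger0_norm ltr_def.

Lemma ler_cval (x y : realpart) : (x <= y) = (cval x <= cval y).
Proof. by []. Qed.

HB.instance Definition _ :=
  GRing.isZmodMorphism.Build _ _ cval (fun _ _ => erefl).
HB.instance Definition _ :=
  GRing.isMonoidMorphism.Build _ _ cval (erefl, fun _ _ => erefl).

Lemma cval_inj : injective cval.
Proof. exact: val_inj. Qed.

(** The coefficients are real, so conjugation fixes the polynomial and permutes its roots. *)
Lemma cval_map_poly_conj (p : {poly realpart}) (z : C) :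
  root (map_poly cval p) z -> root (map_poly cval p) z^*.
Proof.
have cK : map_poly (@Num.conj C) (map_poly cval p) = map_poly cval p.
  by rewrite -map_poly_comp; apply: eq_map_poly => x /=; apply/conj_Creal/cvalP.
by move=> pz; rewrite -cK fmorph_root.
Qed.

(** Induction on the size of [p]. A complex root yields a real root in the interval, or a linear or
    quadratic real factor of constant sign on it, which can be divided out. The sign condition is
    put on the product [p.[a] * p.[b]] because it then survives division by a factor of either
    sign. *)
Lemma realpart_ivt_mul (p : {poly realpart}) a b :
  a <= b -> p.[a] * p.[b] <= 0 -> exists2 x, a <= x <= b & root p x.
Proof.
have [n] := ubnP (size p); elim: n => // n IH in p *; rewrite ltnS => szp le_ab pab.
have [p0|pa] := eqVneq p.[a] 0.
  by exists a; rewrite ?lexx // rootE p0.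
have p0 : p != 0 by apply: contraNneq pa => ->; rewrite horner0.
have divides (d : {poly realpart}) : (1 < size d)%N -> d %| p ->
    0 < d.[a] * d.[b] -> exists2 x, a <= x <= b & root p x.
  move=> szd /dvdpP[q pE] dab.
  have q0 : q != 0 by apply: contraNneq p0 => q0; rewrite pE q0 mul0r.
  have d0 : d != 0 by rewrite -size_poly_gt0 ltnW.
  have [|//||x xab qx] := IH q; last by exists x; rewrite // pE rootM qx.
  - move: szp; rewrite pE size_mul //; case: (size d) szd => [|[|m]] // _.
    by rewrite addnS /= addnS; apply: leq_ltn_trans; apply: leq_addr.
  - by move: pab; rewrite pE !hornerM mulrACA pmulr_lle0.
(* A nonzero constant [c] is excluded since [c ^+ 2 <= 0] would follow. *)
have [z pz] : exists z : C, root (map_poly cval p) z.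
  apply/closed_rootP; rewrite size_map_poly; apply/negP => /size_poly1P[c c0 pc].
  by move: pab; rewrite pc !hornerC -expr2 le_eqVlt sqrf_eq0 (negPf c0) ltNge sqr_ge0.
have [zR|zNR] := boolP (z \is Num.real).
  pose r := RealPart zR; have pr : root p r.
    by rewrite -(fmorph_root cval).
  have [rab|rNab] := boolP (a <= r <= b); first by exists r.
  apply: (divides ('X - r%:P)); rewrite ?size_XsubC ?dvdp_XsubCl //.
  rewrite !hornerXsubC; move: rNab; rewrite negb_and -!ltNge => /orP[lt|lt].
    by rewrite mulr_gt0 // subr_gt0 // (lt_le_trans lt).
  by rewrite nmulr_rgt0 subr_lt0 // (le_lt_trans le_ab).
have sR : z + z^* \is Num.real by apply/CrealP; rewrite rmorphD /= conjCK addrC.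
have tR : z * z^* \is Num.real by apply: ger0_real; apply: mul_conjC_ge0.
pose d := 'X^2 - RealPart sR *: 'X + (RealPart tR)%:P.
have dE : map_poly cval d = ('X - z%:P) * ('X - z^*%:P).
  rewrite rmorphD rmorphB /= map_polyXn map_polyZ map_polyX map_polyC /=.
  by rewrite -mul_polyC polyCD polyCM; ring.
(* At a real [u] the two factors of [d] are conjugate, and they are nonzero because [z] is not
   real. *)
have d_gt0 u : 0 < d.[u].
  change (0 < cval d.[u]); rewrite -horner_map dE hornerM !hornerXsubC /=.
  rewrite -{2}(conj_Creal (cvalP u)) -rmorphB /= mul_conjC_gt0 subr_eq0.
  by apply: contraNneq zNR => <-; apply: cvalP.
apply: (divides d); last by rewrite mulr_gt0.
  by rewrite -(size_map_poly cval) dE size_Mmonic ?monicXsubC ?polyXsubC_eq0 // !size_XsubC.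
rewrite -(dvdp_map cval) dE Gauss_dvdp ?dvdp_XsubCl ?pz ?cval_map_poly_conj //.
rewrite coprimep_XsubC rootE hornerXsubC subr_eq0.
by apply: contra zNR => /eqP zJ; apply/CrealP.
Qed.

Lemma realpart_ivt : Num.real_closed_axiom realpart.
Proof.
move=> p a b le_ab /andP[pa pb]; apply: realpart_ivt_mul => //.
exact: mulr_le0_ge0.
Qed.

HB.instance Definition _ := Num.RealField_isClosed.Build realpart realpart_ivt.

End RealElements.
Arguments cval {C} _.

(** * Suprema of definable sets in a real closed field *)

Notation oformula := ordered_qelim.ord.formula.
Notation oholds := ordered_qelim.ord.holds.
Notation oqf_eval := ordered_qelim.ord.qf_eval.

Section DefinableSup.
Variable R : rcfType.
Implicit Types (e : seq R) (f : oformula R) (p : {poly R}).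

Definition term_poly e i (t : GRing.term R) : {poly R} :=
  qe_rcf.eval_poly e (qe_rcf.abstrX i (qe_rcf.to_rterm t)).

Lemma term_polyP e i t x :
  GRing.rterm t -> (term_poly e i t).[x] = GRing.eval (set_nth 0 e i x) t.
Proof. by move=> rt; rewrite qe_rcf.abstrXP qe_rcf.evalE qe_rcf.to_rtermE. Qed.

Lemma sgr_no_root p x y : x <= y -> (forall z, x <= z <= y -> ~~ root p z) ->
  Num.sg p.[x] = Num.sg p.[y].
Proof.
move=> le_xy noroot.
have px0 : p.[x] != 0 by apply: (noroot x); rewrite lexx.
have py0 : p.[y] != 0 by apply: (noroot y); rewrite lexx andbT.
have pos : 0 < p.[x] * p.[y].
  rewrite ltNge; apply/negP => /(polyrcf.poly_ivt le_xy)[z].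
  by rewrite in_itv /= => /noroot /negPf->.
have : Num.sg (p.[x] * p.[y]) = 1 by apply/eqP; rewrite sgr_cp0.
rewrite sgrM => sxy.
have sy0 : Num.sg p.[y] != 0 by rewrite sgr_eq0.
by apply: (mulIf sy0); rewrite sxy -expr2 sqr_sg py0.
Qed.

Definition constant_off_roots (T : Type) p (g : R -> T) := forall x y, x <= y ->
  (forall z, x <= z <= y -> ~~ root p z) -> g x = g y.

(** An atom depends on the sign of a polynomial in variable [i], which changes only at a root; if
    that polynomial is zero, the constant 1 serves. For compound formulas the product of the
    polynomials has all the roots needed. *)
Lemma qf_eval_locally_constant e i f :
  ordered_qelim.ord.qf_form f -> ordered_qelim.ord.rformula f ->
  exists2 p, p != 0 & constant_off_roots p (fun x => oqf_eval (set_nth 0 e i x) f).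
Proof.
have atom t1 t2 : GRing.rterm t1 -> GRing.rterm t2 ->
    exists2 p, p != 0 & constant_off_roots p (fun x => Num.sg
      (GRing.eval (set_nth 0 e i x) t1 - GRing.eval (set_nth 0 e i x) t2)).
  move=> r1 r2; pose g := term_poly e i t1 - term_poly e i t2.
  have gE x : GRing.eval (set_nth 0 e i x) t1 - GRing.eval (set_nth 0 e i x) t2 = g.[x].
    by rewrite !hornerE !term_polyP.
  have [g0|g0] := eqVneq g 0.
    by exists 1; rewrite ?oner_neq0 // => x y _ _; rewrite !gE g0 !horner0.
  by exists g => // x y le_xy; rewrite !gE; apply: sgr_no_root.
have comb f1 f2 (op : bool -> bool -> bool) :
    (exists2 p, p != 0 & constant_off_roots p (fun x => oqf_eval (set_nth 0 e i x) f1)) ->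
    (exists2 p, p != 0 & constant_off_roots p (fun x => oqf_eval (set_nth 0 e i x) f2)) ->
    exists2 p, p != 0 & constant_off_roots p (fun x =>
      op (oqf_eval (set_nth 0 e i x) f1) (oqf_eval (set_nth 0 e i x) f2)).
  move=> [p p0 pP] [q q0 qP]; exists (p * q); first by rewrite mulf_neq0.
  move=> x y le_xy noroot; congr op.
    by apply: pP => // z /noroot; rewrite rootM negb_or => /andP[].
  by apply: qP => // z /noroot; rewrite rootM negb_or => /andP[].
elim: f => //=.
- by move=> b _ _; exists 1; rewrite ?oner_neq0.
- move=> t1 t2 _ /andP[r1 r2]; have [p p0 pP] := atom t1 t2 r1 r2.
  exists p => // x y le_xy /(pP _ _ le_xy) eq_sg.
  by rewrite -[LHS]subr_eq0 -[RHS]subr_eq0 -sgr_eq0 eq_sg sgr_eq0.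
- move=> t1 t2 _ /andP[r1 r2]; have [p p0 pP] := atom t1 t2 r1 r2.
  exists p => // x y le_xy /(pP _ _ le_xy) eq_sg.
  by rewrite -[LHS]subr_lt0 -[RHS]subr_lt0 -sgr_lt0 eq_sg sgr_lt0.
- move=> t1 t2 _ /andP[r1 r2]; have [p p0 pP] := atom t1 t2 r1 r2.
  exists p => // x y le_xy /(pP _ _ le_xy) eq_sg.
  by rewrite -[LHS]subr_le0 -[RHS]subr_le0 -sgr_le0 eq_sg sgr_le0.
- move=> f1 IH1 f2 IH2 /andP[q1 q2] /andP[r1 r2].
  by apply: (comb f1 f2 andb); [apply: IH1|apply: IH2].
- move=> f1 IH1 f2 IH2 /andP[q1 q2] /andP[r1 r2].
  by apply: (comb f1 f2 orb); [apply: IH1|apply: IH2].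
- move=> f1 IH1 f2 IH2 /andP[q1 q2] /andP[r1 r2].
  by apply: (comb f1 f2 implb); [apply: IH1|apply: IH2].
- move=> f IH q r; have [p p0 pP] := IH q r.
  by exists p => // x y le_xy /(pP _ _ le_xy) ->.
Qed.

(** Quantifier elimination reduces this to the quantifier-free case. *)
Lemma definable_locally_constant e i f :
  exists2 p : {poly R}, p != 0 & forall x y, x <= y ->
    (forall z, x <= z <= y -> ~~ root p z) ->
    oholds (set_nth 0 e i x) f <-> oholds (set_nth 0 e i y) f.
Proof.
have wf := ordered_qelim.ord.quantifier_elim_wf (@qe_rcf.wf_QE_wproj R)
  (ordered_qelim.ord.to_rform_rformula f).
have /andP[qff rff] := wf.
have [p p0 pP] := qf_eval_locally_constant e i qff rff.
exists p => // x y le_xy /(pP _ _ le_xy) eq_f.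
by split=> /(qe_rcf.rcf_satP _ _) h; apply/qe_rcf.rcf_satP; move: h;
  rewrite /qe_rcf.rcf_sat /ordered_qelim.ord.proj_sat eq_f.
Qed.

Lemma ex_min_seq (s : seq R) : s != [::] ->
  exists2 m, m \in s & forall y, y \in s -> m <= y.
Proof.
elim: s => // x [|x' s] IH _.
  by exists x; rewrite ?mem_head // => y; rewrite inE => /eqP->.
have [//|m ms mP] := IH; exists (Num.min x m).
  by rewrite minEle; case: ifP; rewrite inE ?eqxx // ms orbT.
move=> y; rewrite inE => /orP[/eqP->|/mP le_my]; first by rewrite ge_min lexx.
by rewrite ge_min le_my orbT.
Qed.

(** Membership in the set changes only at the finitely many roots of one polynomial, so the supremum
    can be sought among these instead of by completeness. *)
Lemma definable_sup e i f (b : R) :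
  (exists x, oholds (set_nth 0 e i x) f) ->
  (forall x, oholds (set_nth 0 e i x) f -> x <= b) ->
  exists s, (forall x, oholds (set_nth 0 e i x) f -> x <= s) /\
    (forall t, t < s -> exists2 x, oholds (set_nth 0 e i x) f & t < x).
Proof.
move=> [x0 Dx0] Db; set D := fun x => oholds (set_nth 0 e i x) f in Db *.
(* Being an upper bound is expressed by a formula, hence decidable through [rcf_sat]. *)
pose isub r := ~~ qe_rcf.rcf_sat e
  (ordered_qelim.ord.Exists i (ordered_qelim.ord.And f
     (ordered_qelim.ord.Lt (GRing.Const r) (GRing.Var _ i)))).
have isubP r : isub r -> forall x, D x -> x <= r.
  move=> /qe_rcf.rcf_satP nex x Dx; rewrite leNgt; apply/negP => lt_rx.
  by apply: nex; exists x; split=> //=; rewrite nth_set_nth /= eqxx.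
have isubPn r : ~~ isub r -> exists2 x, D x & r < x.
  move=> /negPn/qe_rcf.rcf_satP[x [Dx]] /=; rewrite nth_set_nth /= eqxx => lt_rx.
  by exists x.
have isub_b r : (forall x, D x -> x <= r) -> isub r.
  by move=> rub; apply: contraT => /isubPn[x /rub]; rewrite leNgt => /negP.
have [p p0 pP] := definable_locally_constant e i f.
have rootsE z : root p z = (z \in rootsR p).
  by rewrite -(roots_on_rootsR p0) in_itv.
have above (l : seq R) : ~~ has isub l ->
    exists2 x, D x & forall z, z \in l -> z < x.
  elim: l => [_|z l IH /=]; first by exists x0.
  rewrite negb_or => /andP[/isubPn[x Dx lt_zx] /IH[y Dy yP]].
  have [le_xy|lt_yx] := leP x y.
    exists y => // w; rewrite inE => /orP[/eqP->|/yP//].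
    exact: lt_le_trans le_xy.
  exists x => // w; rewrite inE => /orP[/eqP->//|/yP lt_wy].
  exact: lt_trans lt_yx.
(* Otherwise some [x] in [D] exceeds every root up to [y]. No root then lies between [x] and [y], so
   [y] is in [D], although it is larger than the upper bound [t]. *)
have K t y : isub t -> t < y -> exists z, [/\ root p z, isub z & z <= y].
  move=> ubt lt_ty; set l := [seq z <- rootsR p | z <= y].
  have [/hasP[z]|/above[x Dx xP]] := boolP (has isub l).
    by rewrite mem_filter => /andP[le_zy]; rewrite -rootsE => rz ubz; exists z.
  have le_xt := isubP _ ubt _ Dx.
  suff /(isubP _ ubt) : D y by rewrite leNgt lt_ty.
  apply/(pP x y) => //; first exact: le_trans (ltW lt_ty).
  move=> z /andP[le_xz le_zy]; apply/negP; rewrite rootsE => rz.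
  by have := xP z; rewrite mem_filter le_zy rz ltNge le_xz => /(_ isT).
(* The supremum is the least root of [p] that bounds [D] from above. *)
have [|r] := @ex_min_seq (filter isub (rootsR p)).
  have [|z []] := @K b (b + 1) (isub_b _ Db); first by rewrite ltrDl.
  by rewrite rootsE => rz ubz _; apply/eqP => /(congr1 (fun s => z \in s));
    rewrite mem_filter rz ubz.
rewrite mem_filter => /andP[ubr _] rmin; exists r; split; first exact: isubP.
move=> t lt_tr; have [ubt|/isubPn//] := boolP (isub t).
(* The midpoint of [t] and [r] makes the root obtained strictly smaller than [r], against
   minimality. *)
have [z []] := K t _ ubt (midf_lt lt_tr).1.
rewrite rootsE => rz ubz; rewrite leNgt => /negP[].
by apply: lt_le_trans (midf_lt lt_tr).2 _; apply: rmin; rewrite mem_filter ubz.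
Qed.

End DefinableSup.

(** * Maxima of polynomials on closed definable subsets of the unit cube *)

Section ExtremeValue.
Variables (R : rcfType) (n : nat).
Implicit Types (e y z : seq R) (f : oformula R).
Import ordered_qelim.ord.

Lemma nth_setE e i j (x : R) :
  (set_nth 0 e i x)`_j = if j == i then x else e`_j.
Proof. exact: nth_set_nth. Qed.

Lemma holds_foldr_Exists s e f : oholds e (foldr Exists f s) <->
  exists2 e', (forall i, i \notin s -> e'`_i = e`_i) & oholds e' f.
Proof.
elim: s e => [|i s IH] e /=.
  split=> [fe|[e' e'e]]; first by exists e.
  by apply: eq_holds => i; apply: e'e.
split=> [[x /IH[e' e'e fe']]|[e' e'e fe']].
  exists e' => // j; rewrite inE negb_or => /andP[neq_ji /e'e->].
  by rewrite nth_setE (negPf neq_ji).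
exists e'`_i; apply/IH; exists e' => // j js; rewrite nth_setE.
by have [->//|neq_ji] := eqVneq j i; rewrite e'e // inE negb_or neq_ji.
Qed.

Lemma holds_foldr_And (T : Type) (F : T -> oformula R) (s : seq T) e :
  oholds e (foldr (fun x => And (F x)) (Bool true) s) <->
  all (fun x => qe_rcf.rcf_sat e (F x)) s.
Proof.
elim: s => //= x s IH; split=> [[/qe_rcf.rcf_satP-> /IH]|] //.
by move=> /andP[/qe_rcf.rcf_satP ? /IH].
Qed.

(* A definable family of sets of points (X_0, ..., X_(n-1)), indexed by X_n > 0
   and increasing with X_n. *)
Definition nested_family f :=
  (forall e e', (forall i, (i < n)%N -> e'`_i = e`_i) -> e`_n <= e'`_n ->
     oholds e f -> oholds e' f) /\
  (forall d : R, 0 < d -> exists2 e, e`_n = d & oholds e f).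

(** The radius is the index [X_n] itself, so adding this condition keeps a family increasing in its
    index. *)
Definition near_coord (j : nat) (v : R) : oformula R :=
  (And (Lt (GRing.Add (GRing.Var _ j) (GRing.Opp (GRing.Const v))) (GRing.Var _ n))
       (Lt (GRing.Add (GRing.Const v) (GRing.Opp (GRing.Var _ j))) (GRing.Var _ n))).

(* [v] is the supremum of the [c] such that [c <= X_j] on some member of the family. *)
Lemma nested_family_limit1 f j : (j < n)%N -> nested_family f ->
  (forall e, oholds e f -> 0 <= e`_j <= 1) ->
  exists v, nested_family (And f (near_coord j v)).
Proof.
move=> ltjn [fmono fex] fbnd.
(* Variable [n.+1] holds a candidate lower bound for [X_j]; [low] says that it fails on the member
   of index [X_n]. *)
pose low := foldr Exists (And f (Lt (GRing.Var _ j) (GRing.Var _ n.+1))) (iota 0 n).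
have lowP e : oholds e low <->
    exists2 e', e'`_n = e`_n & oholds e' f /\ e'`_j < e`_n.+1.
  rewrite holds_foldr_Exists; split=> [[e' e'e [/= fe' lt_c]]|[e' e'n [fe' lt_c]]].
    exists e'; first by apply: e'e; rewrite mem_iota ltnn.
    by split=> //; rewrite -e'e // mem_iota ltnNge leqnSn.
  (* The length [n + size e] covers all of [e]; beyond it both lists read 0. *)
  exists (mkseq (fun i => if (i < n)%N then e'`_i else e`_i) (n + size e)).
    move=> i; rewrite mem_iota /= add0n -leqNgt => le_ni.
    have [lti|lei] := ltnP i (n + size e).
      by rewrite nth_mkseq // ltnNge le_ni.
    rewrite !nth_default ?size_mkseq //.
    by apply: leq_trans lei; apply: leq_addl.
  have nthE i : (mkseq (fun i => if (i < n)%N then e'`_i else e`_i) (n + size e))`_i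
      = if (i < n)%N then e'`_i else e`_i.
    have [lti|lei] := ltnP i (n + size e); first by rewrite nth_mkseq.
    have le_ni : (n <= i)%N by apply: leq_trans lei; apply: leq_addr.
    rewrite nth_default ?size_mkseq // ltnNge le_ni /= nth_default //.
    by apply: leq_trans lei; apply: leq_addl.
  split=> /=; last by rewrite !nthE ltjn ltnNge leqnSn.
  apply: fmono fe' => [i lti|]; first by rewrite nthE lti.
  by rewrite nthE ltnn e'n.
have [b0 _] : exists b0 : seq R, b0 = [::] by exists [::].
pose D := Exists n (And (Lt (GRing.NatConst _ 0) (GRing.Var _ n)) (Not low)).
have DP c : oholds (set_nth 0 b0 n.+1 c) D <->
    exists2 d : R, 0 < d & forall e, e`_n = d -> oholds e f -> c <= e`_j.
  split=> [[d [/=]]|[d d0 dP]].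
    rewrite nth_setE eqxx => d0 nlow; exists d => // e en fe.
    rewrite leNgt; apply/negP => lt_c; apply: nlow; apply/lowP; exists e.
      by rewrite nth_setE eqxx.
    by split=> //; rewrite !nth_setE !eqxx gtn_eqF.
  exists d; split; first by rewrite /= nth_setE eqxx.
  move/lowP => [e]; rewrite !nth_setE !eqxx => en [fe].
  rewrite gtn_eqF //.
  by rewrite ltNge (dP e).
have [s [sub slub]] : exists s : R,
    (forall x, oholds (set_nth 0 b0 n.+1 x) D -> x <= s) /\
    (forall t, t < s -> exists2 x, oholds (set_nth 0 b0 n.+1 x) D & t < x).
  apply: (@definable_sup _ _ _ _ 1).
    exists 0; apply/DP; exists 1 => // e _ /fbnd /andP[] //.
  move=> c /DP[d /fex[e en fe] /(_ e en fe) le_c].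
  by apply: le_trans le_c _; have /andP[] := fbnd e fe.
exists s; split.
  move=> e e' agr le_n [fe /= [lt1 lt2]]; split; first exact: fmono fe.
  by rewrite /= (agr j) //; split; apply: lt_le_trans le_n.
move=> d d0; have [|c /DP[d1 d10 d1P] lt_c] := slub (s - d).
  by rewrite gtrBl.
(* The member of index [m] lies in those of index [d] and [d1]. Its points satisfy
   [s - d < c <= X_j], and one of them has [X_j < s + d] because [s + d] is beyond the supremum. *)
pose m := Num.min d d1; have m0 : 0 < m by rewrite lt_min d0.
pose e0 := set_nth 0 (set_nth 0 b0 n.+1 (s + d)) n m.
have : oholds e0 low.
  case: (qe_rcf.rcf_satP e0 low) => // nlow; exfalso.
  suff /sub : oholds (set_nth 0 b0 n.+1 (s + d)) D by rewrite gerDl leNgt d0.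
  by exists m; split=> //=; rewrite nth_setE eqxx.
move/lowP=> [e]; rewrite !nth_setE !eqxx gtn_eqF //.
move=> en [fe lt_j].
have le_c : c <= e`_j.
  have := d1P (set_nth 0 e n d1); rewrite !nth_setE !eqxx ltn_eqF //; apply=> //.
  apply: fmono fe => [i lti|]; rewrite nth_setE ?eqxx ?ltn_eqF //.
  by rewrite en ge_min lexx orbT.
exists (set_nth 0 e n d); first by rewrite nth_setE eqxx.
split=> /=; last first.
  rewrite !nth_setE !eqxx ltn_eqF //; split; first by rewrite ltrBlDl.
  by rewrite ltrBlDr -ltrBlDl (lt_le_trans lt_c).
apply: fmono fe => [i lti|]; rewrite nth_setE ?eqxx ?ltn_eqF //.
by rewrite en ge_min lexx.
Qed.

(** A substitute for compactness of the cube: the coordinates of a cluster point are chosen one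
    after the other, each choice refining the family to points near the chosen value. *)
Lemma nested_family_limit f : nested_family f ->
  (forall e, oholds e f -> forall j, (j < n)%N -> 0 <= e`_j <= 1) ->
  exists y, forall d : R, 0 < d -> exists2 e, e`_n = d &
    oholds e f /\ forall j, (j < n)%N -> `|e`_j - y`_j| < d.
Proof.
move=> famf fbnd.
have H m : (m <= n)%N -> exists y, exists2 f', nested_family f' &
    forall e, oholds e f' -> oholds e f /\
      forall j, (j < m)%N -> `|e`_j - y`_j| < e`_n.
  elim: m => [|m IH] le_mn; first by exists [::], f.
  have [y [f' famf' f'P]] := IH (ltnW le_mn).
  have [e /f'P[/fbnd bnd _]|v famv] := nested_family_limit1 le_mn famf'.
    exact: bnd.
  exists (set_nth 0 y m v); exists (And f' (near_coord m v)) => // e [/f'P[fe yP] /= [lt1 lt2]].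
  split=> // j; rewrite ltnS leq_eqVlt nth_setE => /orP[/eqP->|ltj].
    by rewrite eqxx ltr_norml lt1 andbT ltrNl opprB.
  by rewrite ltn_eqF // yP.
have [y [f' [_ f'ex] f'P]] := H n (leqnn n).
by exists y => d /f'ex[e en /f'P]; rewrite en => ef; exists e.
Qed.

Definition eval_continuous y (F : seq R -> R) := forall d : R, 0 < d ->
  exists2 d' : R, 0 < d' & forall e, (forall i, `|e`_i - y`_i| < d') -> `|F e - F y| < d.

Lemma eval_continuousD y F G : eval_continuous y F -> eval_continuous y G ->
  eval_continuous y (fun e => F e + G e).
Proof.
move=> cF cG d d0; have d20 : 0 < d / 2 by rewrite divr_gt0.
have [d1 d10 d1P] := cF _ d20; have [d2 d2_gt0 d2P] := cG _ d20.
exists (Num.min d1 d2) => [|e eP]; first by rewrite lt_min d10.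
have h1 : `|F e - F y| < d / 2.
  by apply: d1P => i; apply: lt_le_trans (eP i) _; rewrite ge_min lexx.
have h2 : `|G e - G y| < d / 2.
  by apply: d2P => i; apply: lt_le_trans (eP i) _; rewrite ge_min lexx orbT.
by move: h1 h2; rewrite !ltr_norml; lra.
Qed.

Lemma eval_continuousM y F G : eval_continuous y F -> eval_continuous y G ->
  eval_continuous y (fun e => F e * G e).
Proof.
move=> cF cG d d0.
(* If both increments are below [m <= 1], then [|F e| <= |F y| + 1], so the product changes by less
   than [M * m <= d]. *)
pose M := `|F y| + `|G y| + 1.
have M0 : 0 < M by rewrite ltr_wpDl ?addr_ge0.
pose m := Num.min 1 (d / M).
have m0 : 0 < m by rewrite lt_min ltr01 divr_gt0.
have [d1 d10 d1P] := cF _ m0; have [d2 d2_gt0 d2P] := cG _ m0.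
exists (Num.min d1 d2) => [|e eP]; first by rewrite lt_min d10.
have h1 : `|F e - F y| < m.
  by apply: d1P => i; apply: lt_le_trans (eP i) _; rewrite ge_min lexx.
have h2 : `|G e - G y| < m.
  by apply: d2P => i; apply: lt_le_trans (eP i) _; rewrite ge_min lexx orbT.
have -> : F e * G e - F y * G y = F e * (G e - G y) + (F e - F y) * G y by ring.
have m1 : m <= 1 by rewrite ge_min lexx.
have md : M * m <= d by rewrite mulrC -ler_pdivlMr // ge_min lexx orbT.
have hF : `|F e| <= `|F y| + 1.
  rewrite -(subrK (F y) (F e)) addrC; apply: le_trans (ler_normD _ _) _.
  by rewrite lerD2l (le_trans (ltW h1)).
apply: le_lt_trans (ler_normD _ _) _; rewrite !normrM.
apply: lt_le_trans md; rewrite /M addrAC mulrDl; apply: ltr_leD.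
  apply: le_lt_trans (ler_wpM2r _ hF) _ => //.
  by rewrite ltr_pM2l // ltr_wpDl.
by rewrite mulrC ler_wpM2l // ltW.
Qed.

Lemma eq_eval_continuous y F G : F =1 G -> eval_continuous y F -> eval_continuous y G.
Proof.
move=> FG cF d /cF[d' d'0 d'P]; exists d' => // e /d'P.
by rewrite !FG.
Qed.

Lemma eval_continuous_term y t : GRing.rterm t ->
  eval_continuous y (fun e => GRing.eval e t).
Proof.
have cst (c : R) : eval_continuous y (fun=> c).
  by move=> d d0; exists 1 => // e _; rewrite subrr normr0.
elim: t => //=.
- by move=> i _ d d0; exists d.
- by move=> t1 IH1 t2 IH2 /andP[r1 r2]; apply: eval_continuousD; [apply: IH1|apply: IH2].
- move=> t IH r d d0; have [d' d'0 d'P] := IH r d d0.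
  by exists d' => // e /d'P; rewrite -opprD normrN.
- move=> t IH m r; elim: m => [|m IHm]; first exact: cst.
  apply: (@eq_eval_continuous _ (fun e => GRing.eval e t + GRing.eval e t *+ m)).
    by move=> e; rewrite mulrS.
  by apply: eval_continuousD; first exact: IH.
- by move=> t1 IH1 t2 IH2 /andP[r1 r2]; apply: eval_continuousM; [apply: IH1|apply: IH2].
- move=> t IH m r; elim: m => [|m IHm]; first exact: cst.
  apply: (@eq_eval_continuous _ (fun e => GRing.eval e t * GRing.eval e t ^+ m)).
    by move=> e; rewrite exprS.
  by apply: eval_continuousM; first exact: IH.
Qed.

Definition cube e := forall i, (i < n)%N -> 0 <= e`_i <= 1.

Definition local (F : seq R -> R) :=
  forall e e', (forall i, (i < n)%N -> e'`_i = e`_i) -> F e' = F e.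

(** Since [rterm] excludes inverses, a bound can be built along the term. It is needed for the
    supremum of the values on the cube to exist. *)
Lemma eval_bounded_term (b : R) t : 0 <= b -> GRing.rterm t ->
  exists B, forall e, (forall i, `|e`_i| <= b) -> `|GRing.eval e t| <= B.
Proof.
move=> b0; elim: t => //=.
- by move=> i _; exists b.
- by move=> c _; exists `|c|.
- by move=> m _; exists `|m%:R|.
- move=> t1 IH1 t2 IH2 /andP[/IH1[B1 B1P] /IH2[B2 B2P]]; exists (B1 + B2) => e eb.
  by apply: le_trans (ler_normD _ _) _; rewrite lerD ?B1P ?B2P.
- by move=> t IH /IH[B BP]; exists B => e /BP; rewrite normrN.
- move=> t IH m /IH[B BP]; exists (B *+ m) => e /BP.
  by rewrite normrMn lerMn2r => ->; rewrite orbT.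
- move=> t1 IH1 t2 IH2 /andP[/IH1[B1 B1P] /IH2[B2 B2P]]; exists (B1 * B2) => e eb.
  by rewrite normrM ler_pM ?B1P ?B2P.
- move=> t IH m /IH[B BP]; exists (B ^+ m) => e /BP tB.
  by rewrite normrX lerXn2r ?nnegrE // (le_trans _ tB).
Qed.

Definition in_cube : oformula R := foldr (fun i => And
  (And (Le (GRing.NatConst _ 0) (GRing.Var _ i)) (Le (GRing.Var _ i) (GRing.NatConst _ 1))))
  (Bool true) (iota 0 n).

Lemma in_cubeP e : oholds e in_cube <-> cube e.
Proof.
rewrite holds_foldr_And; split=> [/allP H i ltin|H].
  have iin : i \in iota 0 n by rewrite mem_iota.
  by have /qe_rcf.rcf_satP[/= -> ->] := H i iin.
apply/allP => i; rewrite mem_iota => /andP[_ /H/andP[? ?]].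
by apply/qe_rcf.rcf_satP.
Qed.

(** Let [mu] be the supremum of [P] under the constraint. The points where [P] is at least [mu - d]
    form a nested family with index [d]; by continuity [P] is at least [mu] at a cluster point. *)
Lemma polynomial_max (P G : GRing.term R) : GRing.rterm P -> GRing.rterm G ->
  local (fun e => GRing.eval e P) -> local (fun e => GRing.eval e G) ->
  (exists2 e, cube e & GRing.eval e G = 0) ->
  exists y, [/\ cube y, GRing.eval y G = 0 &
    forall e, cube e -> GRing.eval e G = 0 -> GRing.eval e P <= GRing.eval y P].
Proof.
move=> rP rG lP lG [z0 z0c z0G].
have trunc e : exists2 e', forall i, (i < n)%N -> e'`_i = e`_i & forall i, (n <= i)%N -> e'`_i = 0.
  exists (mkseq (nth 0 e) n) => i lti; first by rewrite nth_mkseq.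
  by rewrite nth_default // size_mkseq.
have cube_agree e e' : (forall i, (i < n)%N -> e'`_i = e`_i) -> cube e -> cube e'.
  by move=> agr ce i lti; rewrite agr // ce.
pose K := And in_cube (Equal G (GRing.NatConst _ 0)).
have KP e : oholds e K <-> cube e /\ GRing.eval e G = 0.
  by split=> [[/in_cubeP ce ge]|[ce ge]]; split=> //; apply/in_cubeP.
(* The values of [P] closed downwards, which leaves their supremum unchanged. *)
pose attained := foldr Exists (And K (Le (GRing.Var _ n) P)) (iota 0 n).
have attP t : oholds (set_nth 0 [::] n t) attained <->
    exists e, [/\ cube e, GRing.eval e G = 0 & t <= GRing.eval e P].
  rewrite holds_foldr_Exists; split=> [[e eP [/KP[ce ge] /=]]|[e [ce ge le_t]]].
    rewrite eP ?mem_iota ?ltnn //= nth_setE eqxx => le_t.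
    by exists e.
  have [e' e'e e'0] := trunc e.
  exists (set_nth 0 e' n t).
    move=> i; rewrite mem_iota /= add0n -leqNgt => le_ni.
    by rewrite !nth_setE nth_nil e'0.
  have agr i : (i < n)%N -> (set_nth 0 e' n t)`_i = e`_i.
    by move=> lti; rewrite nth_setE ltn_eqF // e'e.
  split; first by apply/KP; split; [apply: cube_agree ce|rewrite (lG e)].
  by rewrite /= nth_setE eqxx (lP e).
have [B BP] := eval_bounded_term ler01 rP.
have [mu [muub mulub]] : exists mu : R,
    (forall t, oholds (set_nth 0 [::] n t) attained -> t <= mu) /\
    (forall t, t < mu -> exists2 x, oholds (set_nth 0 [::] n x) attained & t < x).
  apply: (@definable_sup _ _ _ _ B).
    by exists (GRing.eval z0 P); apply/attP; exists z0.
  move=> t /attP[e [ce ge le_t]]; have [e' e'e e'0] := trunc e.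
  rewrite (le_trans le_t) // -(lP e e') // (le_trans (ler_norm _)) // BP // => i.
  have [/[dup] lti /e'e->|/e'0->] := ltnP i n; last by rewrite normr0.
  by have /andP[? ?] := ce i lti; rewrite ger0_norm.
pose f := And K (Le (GRing.Add (GRing.Const mu) (GRing.Opp (GRing.Var _ n))) P).
have famf : nested_family f.
  split=> [e e' agr le_n [/KP[ce ge] /= le_P]|d d0].
    split; first by apply/KP; split; [apply: cube_agree ce|rewrite (lG e)].
    by rewrite /= (lP e e') // (le_trans _ le_P) // lerD2l lerN2.
  have [|t /attP[e [ce ge le_t]] lt_t] := mulub (mu - d); first by rewrite gtrBl.
  have agr i : (i < n)%N -> (set_nth 0 e n d)`_i = e`_i.
    by move=> lti; rewrite nth_setE ltn_eqF.
  exists (set_nth 0 e n d); first by rewrite nth_setE eqxx.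
  split; first by apply/KP; split; [apply: cube_agree ce|rewrite (lG e)].
  by rewrite /= nth_setE eqxx (lP e) // (le_trans (ltW lt_t)).
have [e [/KP[ce _] _]|y' y'P] := nested_family_limit famf; first by move=> j /ce.
have [y yy' y0] := trunc y'.
(* Applied to the coordinates, to [G] and to [P], this carries the cube, the constraint and the
   bound [mu] over to [y]. *)
have close (F : seq R -> R) (d : R) : local F -> eval_continuous y F -> 0 < d ->
    exists e, [/\ cube e, GRing.eval e G = 0, mu - d <= GRing.eval e P & `|F e - F y| < d].
  move=> lF cF d0; have [d1 d10 d1P] := cF d d0.
  have [|e en [[/KP[ce ge] /= le_P] eP]] := y'P (Num.min d d1); first by rewrite lt_min d0.
  have [e' e'e e'0] := trunc e.
  exists e; split=> //; first by rewrite (le_trans _ le_P) // lerD2l lerN2 en ge_min lexx.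
  rewrite -(lF e e') //; apply: d1P => i.
  have [lti|le_ni] := ltnP i n; last by rewrite e'0 // y0 // subrr normr0.
  by rewrite e'e // yy' // (lt_le_trans (eP i lti)) // ge_min lexx orbT.
have cP := @eval_continuous_term y P rP; have cG := @eval_continuous_term y G rG.
exists y; split.
- move=> i lti; have ci : eval_continuous y (fun e => e`_i) by move=> d d0; exists d.
  have li : local (fun e => e`_i) by move=> e e' ->.
  rewrite !leNgt -negb_or; apply/negP => /orP[lt0|lt1].
    have [|e [/(_ i lti)/andP[ge0 _] _ _]] := close _ (- y`_i) li ci; first by rewrite oppr_gt0.
    by rewrite ltr_norml => /andP[_]; rewrite ltrBlDr addNr ltNge ge0.
  have [|e [/(_ i lti)/andP[_ le1] _ _]] := close _ (y`_i - 1) li ci; first by rewrite subr_gt0.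
  by rewrite ltr_norml opprB ltrD2r ltNge le1.
- apply/eqP; rewrite -normr_le0 leNgt; apply/negP => G0.
  by have [e [_ -> _]] := close _ _ lG cG G0; rewrite sub0r normrN ltxx.
move=> e ce ge; apply: le_trans (_ : mu <= _).
  by apply: muub; apply/attP; exists e.
(* With [d] half the gap between [mu] and the value at [y], a point cannot be within [d] of the
   latter and at least [mu - d]. *)
rewrite leNgt -subr_gt0; apply/negP => /(fun h => divr_gt0 h (ltr0n R 2)) d0.
have [e' [_ _ le_P]] := close _ _ lP cP d0.
by rewrite ltr_norml => /andP[_]; lra.
Qed.

End ExtremeValue.

(** * The tensors and the associated form, written edge by edge *)

Section AdjacencyTensor.
Variables (n k : nat) (E : {set {set 'I_n}}).
Hypotheses (k_gt0 : (0 < k)%N) (unifE : @uniform n k E).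

(** The partial derivative at [i] of the sum of the edge monomials. *)
Definition link_sum (R : pzSemiRingType) (x : 'I_n -> R) (i : 'I_n) : R :=
  \sum_(e in E | i \in e) \prod_(w in e :\ i) x w.

(** This is [Q_E]; the factor [k%:R] arises because an edge monomial is counted once at each of its
    vertices. *)
Definition alpha_form (R : pzRingType) (a : R) (x : 'I_n -> R) : R :=
  \sum_i a * (deg E i)%:R * x i ^+ k + (1 - a) * k%:R * \sum_(e in E) \prod_(w in e) x w.

Lemma inj_ffun_on_link (e : {set 'I_n}) i (t : {ffun 'I_k.-1 -> 'I_n}) :
  #|e| = k -> i \in e ->
  t \in [set f : {ffun 'I_k.-1 -> 'I_n} in ffun_on (mem (e :\ i)) | injectiveb f] ->
  [set t j | j : 'I_k.-1] = e :\ i.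
Proof.
move=> ek ie; rewrite inE => /andP[/ffun_onP ton /injectiveP tinj].
have cei : #|e :\ i| = k.-1 by rewrite (cardsD1 i e) ie in ek; rewrite -ek.
apply/eqP; rewrite eqEcard cei card_imset // card_ord leqnn andbT.
by apply/subsetP => _ /imsetP[j _ ->]; apply: ton.
Qed.

(** The [k.-1] images have to cover the [k.-1] vertices of [e :\ i], which forces them to be
    distinct and different from [i]. *)
Lemma edge_of_arcsE (e : {set 'I_n}) i (t : {ffun 'I_k.-1 -> 'I_n}) :
  #|e| = k -> i \in e ->
  ([set i] :|: [set t j | j : 'I_k.-1] == e) =
  (t \in [set f : {ffun 'I_k.-1 -> 'I_n} in ffun_on (mem (e :\ i)) | injectiveb f]).
Proof.
move=> ek ie; apply/eqP/idP=> [te|/inj_ffun_on_link->//]; last by rewrite setD1K.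
have cei : #|e :\ i| = k.-1 by rewrite (cardsD1 i e) ie in ek; rewrite -ek.
have ei_sub : e :\ i \subset [set t j | j : 'I_k.-1].
  apply/subsetP => w; rewrite -te !inE => /andP[/negPf->] //.
have le_im : (#|[set t j | j : 'I_k.-1]| <= k.-1)%N.
  by rewrite -[X in (_ <= X)%N](card_ord k.-1) leq_imset_card.
have imE : e :\ i = [set t j | j : 'I_k.-1].
  by apply/eqP; rewrite eqEcard ei_sub cei.
rewrite inE; apply/andP; split; first by apply/ffun_onP => j; rewrite /= imE imset_f.
apply/injectiveP => j1 j2 tj.
have /imset_injP inj : #|[set t j | j : 'I_k.-1]| == #|'I_k.-1|.
  by rewrite -imE cei card_ord.
exact: inj.
Qed.

(** Index tuples are grouped by the edge they form with [i]. An edge arises from the [(k.-1)!]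
    orderings of its other vertices, which cancels the tensor entry. *)
Lemma tapp_adjT (C : numClosedFieldType) (x : 'I_n -> C) i :
  tapp (@adjT C n k E) x i = link_sum x i.
Proof.
rewrite /tapp /adjT /link_sum.
pose arcs (t : {ffun 'I_k.-1 -> 'I_n}) := [set i] :|: [set t j | j : 'I_k.-1].
transitivity (\sum_(t | arcs t \in E) (k.-1)`!%:R^-1 * \prod_(j < k.-1) x (t j)).
  by rewrite [RHS]big_mkcond; apply: eq_bigr => t _; case: ifP; rewrite ?mul0r.
rewrite (partition_big arcs (mem E)) //= [RHS]big_mkcondr; apply: eq_bigr => e eE.
have ek := unifE eE; have [ie|ie] := boolP (i \in e); last first.
  rewrite big_pred0 // => t; apply: contraNF ie => /andP[_ /eqP <-].
  by rewrite !inE eqxx.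
have cei : #|e :\ i| = k.-1 by rewrite (cardsD1 i e) ie in ek; rewrite -ek.
rewrite (eq_bigl (mem [set f : {ffun 'I_k.-1 -> 'I_n} in ffun_on (mem (e :\ i)) | injectiveb f]));
  last first.
  move=> t; rewrite /= -edge_of_arcsE // -/(arcs t).
  by apply: andb_idl => /eqP->.
rewrite (eq_bigr (fun=> (k.-1)`!%:R^-1 * \prod_(w in e :\ i) x w)); last first.
  move=> t tin; congr (_ * _); have := tin; rewrite /= inE => /andP[_ /injectiveP tinj].
  rewrite -(inj_ffun_on_link ek ie tin).
  by rewrite big_imset //=; apply: in2W.
rewrite sumr_const card_inj_ffuns_on card_ord cei ffactnn.
by rewrite -[LHS]mulr_natl mulrA divff ?mul1r // pnatr_eq0 -lt0n fact_gt0.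
Qed.

Lemma tapp_AalphaT (C : numClosedFieldType) (a : C) (x : 'I_n -> C) i :
  tapp (@AalphaT C n k a E) x i =
  a * (deg E i)%:R * x i ^+ k.-1 + (1 - a) * link_sum x i.
Proof.
rewrite -tapp_adjT /tapp /AalphaT mulr_sumr.
under eq_bigr do rewrite mulrDl -!mulrA.
rewrite big_split /= -mulr_sumr -[X in _ = X + _]mulrA; congr (_ * _ + _).
rewrite (bigD1 ([ffun=> i] : {ffun 'I_k.-1 -> 'I_n})) //= [X in _ + X]big1 => [|t neq_t]; last by rewrite /degT (negPf neq_t) mul0r.
rewrite addr0 /degT eqxx; congr (_ * _).
by under eq_bigr do rewrite ffunE; rewrite prodr_const card_ord.
Qed.

Lemma link_sum_mul (R : comPzRingType) (x : 'I_n -> R) i :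
  x i * link_sum x i = \sum_(e in E | i \in e) \prod_(w in e) x w.
Proof.
rewrite mulr_sumr; apply: eq_bigr => e /andP[_ ie].
by rewrite [RHS](big_setD1 i).
Qed.

Lemma alpha_form_sum (R : comPzRingType) (a : R) (x : 'I_n -> R) :
  alpha_form a x =
  \sum_i x i * (a * (deg E i)%:R * x i ^+ k.-1 + (1 - a) * link_sum x i).
Proof.
rewrite /alpha_form; under [RHS]eq_bigr do rewrite mulrDr.
rewrite big_split /=; congr (_ + _).
  by apply: eq_bigr => i _; rewrite mulrCA -exprS prednK.
under [RHS]eq_bigr do rewrite mulrCA link_sum_mul.
rewrite -mulr_sumr -mulrA; congr (_ * _).
rewrite (exchange_big_dep (mem E)) /=; last by move=> i e _ /andP[].
rewrite mulr_sumr; apply: eq_bigr => e eE; rewrite [RHS](eq_bigl (fun i => i \in e)).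
  by rewrite sumr_const (unifE eE) mulr_natl.
by move=> i; rewrite eE.
Qed.

Lemma eq_alpha_form (R : pzRingType) (a : R) (x y : 'I_n -> R) :
  x =1 y -> alpha_form a x = alpha_form a y.
Proof.
move=> xy; congr (_ + _ * _); first by apply: eq_bigr => i _; rewrite xy.
by apply: eq_bigr => e _; apply: eq_bigr => w _; rewrite xy.
Qed.

Lemma alpha_form_homo (R : comPzRingType) (a c : R) (x : 'I_n -> R) :
  alpha_form a (fun i => c * x i) = c ^+ k * alpha_form a x.
Proof.
rewrite /alpha_form mulrDr; congr (_ + _).
  by rewrite mulr_sumr; apply: eq_bigr => i _; rewrite exprMn mulrCA.
rewrite [RHS]mulrCA; congr (_ * _); rewrite mulr_sumr; apply: eq_bigr => e eE.
by rewrite big_split /= prodr_const (unifE eE).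
Qed.

(** Edges are sets, so the edge part is affine in the coordinate [i], with slope given by
    [link_sum x i]. *)
Lemma alpha_form_update (R : comPzRingType) (a s : R) (x : 'I_n -> R) i :
  alpha_form a (fun j => if j == i then s else x j) =
  alpha_form a x + a * (deg E i)%:R * (s ^+ k - x i ^+ k) +
  (1 - a) * k%:R * ((s - x i) * link_sum x i).
Proof.
set z := fun j => _.
have zi : z i = s by rewrite /z eqxx.
have zj j : j != i -> z j = x j by rewrite /z => /negPf->.
rewrite /alpha_form.
have -> : \sum_(e in E) \prod_(w in e) z w =
    \sum_(e in E) \prod_(w in e) x w + (s - x i) * link_sum x i.
  rewrite /link_sum big_mkcondr /= mulr_sumr -big_split; apply: eq_bigr => e eE /=.
  have [ie|ie] := boolP (i \in e); last first.
    rewrite mulr0 addr0; apply: eq_bigr => w we.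
    by apply: zj; apply: contraNneq ie => <-.
  rewrite !(big_setD1 i ie) /= zi mulrBl addrC subrK; congr (_ * _).
  by apply: eq_bigr => w; rewrite !inE => /andP[/zj].
rewrite (bigD1 i) //= [X in _ = X + _ + _ + _](bigD1 i) //= zi.
rewrite (eq_bigr (fun j => a * (deg E j)%:R * x j ^+ k)); last by move=> j /zj->.
by ring.
Qed.

Lemma rmorph_alpha_form (R S : comPzRingType) (g : {rmorphism R -> S}) a (x : 'I_n -> R) :
  g (alpha_form a x) = alpha_form (g a) (g \o x).
Proof.
rewrite rmorphD !rmorphM rmorphB rmorph1 rmorph_nat !rmorph_sum.
congr (_ + _ * _); apply: eq_bigr => i _; last by rewrite rmorph_prod.
by rewrite !rmorphM rmorph_nat rmorphXn.
Qed.

Lemma rmorph_link_sum (R S : comPzRingType) (g : {rmorphism R -> S}) (x : 'I_n -> R) i :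
  g (link_sum x i) = link_sum (g \o x) i.
Proof. by rewrite rmorph_sum; apply: eq_bigr => A _; rewrite rmorph_prod. Qed.

End AdjacencyTensor.

(** * Maximizers of the form and their eigenvalue equations *)

Section Maximizer.
Variable R : rcfType.

(** Factor [p - p.[y]] as [q * ('X - y)], so that the derivative at [y] is [q.[y]]. Minimality makes
    [q] nonnegative to the right of [y] and nonpositive between 0 and [y]; continuity of [q]
    concludes. *)
Lemma deriv_half_line_min (p : {poly R}) (y : R) : 0 <= y ->
  (forall s, 0 <= s -> p.[y] <= p.[s]) ->
  0 <= p^`().[y] /\ (0 < y -> p^`().[y] = 0).
Proof.
move=> y0 pmin.
have /factor_theorem[q pE] : root (p - p.[y]%:P) y.
  by rewrite rootE !hornerE subrr.
have p'E : p^`().[y] = q.[y].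
  have -> : p = q * ('X - y%:P) + p.[y]%:P by rewrite -pE subrK.
  by rewrite !derivE !hornerE /= subrr; ring.
have qs s : 0 <= s -> 0 <= q.[s] * (s - y).
  move=> /pmin; rewrite -subr_ge0.
  by have := congr1 (horner^~ s) pE; rewrite !hornerE => ->.
have q_ge0 : 0 <= q.[y].
  rewrite leNgt; apply/negP => qy; rewrite -oppr_gt0 in qy.
  have [d d0 dP] := poly_cont y q qy.
  have d20 : 0 < d / 2 by rewrite divr_gt0.
  have := dP (y + d / 2); rewrite addrAC subrr add0r gtr0_norm // => h.
  have {h} : `|q.[y + d / 2] - q.[y]| < - q.[y] by apply: h; lra.
  rewrite ltr_norml => /andP[_]; rewrite ltrBlDr addNr => qneg.
  have := qs (y + d / 2); rewrite addr_ge0 ?(ltW d20) // => /(_ isT).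
  by rewrite addrAC subrr add0r pmulr_lge0 // leNgt qneg.
rewrite p'E; split=> // y_gt0; apply/eqP; rewrite eq_le q_ge0 andbT leNgt.
apply/negP => qy; have [d d0 dP] := poly_cont y q qy.
pose m := Num.min y (d / 2).
have m0 : 0 < m by rewrite lt_min y_gt0 divr_gt0.
have md : m < d by rewrite gt_min; apply/orP; right; lra.
have /dP : `|(y - m) - y| < d by rewrite addrAC subrr add0r normrN gtr0_norm.
rewrite ltr_norml => /andP[+ _]; rewrite ltrBrDr addNr => qpos.
have := qs (y - m); rewrite subr_ge0 ge_min lexx => /(_ isT).
by rewrite addrAC subrr add0r mulrN oppr_ge0 pmulr_rle0 // leNgt m0.
Qed.

(** The intermediate value theorem applies on [[0, c + 1]], as [(c + 1) ^+ k >= c + 1]. *)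
Lemma ex_nneg_root (k : nat) (c : R) : (0 < k)%N -> 0 <= c -> exists2 r, 0 <= r & r ^+ k = c.
Proof.
move=> k0 c0; have c1 : 0 <= c + 1 by rewrite addr_ge0.
have [|r /andP[r0 _] rr] := @poly_ivt _ ('X^k - c%:P) 0 (c + 1) c1.
  rewrite !hornerE expr0n gtn_eqF //= sub0r oppr_le0 c0 /= subr_ge0.
  have c11 : 1 <= c + 1 by rewrite lerDr.
  by rewrite (le_trans _ (ler_eXnr _ _)) ?lerDl.
by exists r => //; move: rr; rewrite rootE !hornerE subr_eq0 => /eqP.
Qed.

Variables (n k : nat) (E : {set {set 'I_n}}) (a : R).
Hypotheses (k_gt1 : (1 < k)%N) (unifE : @uniform n k E) (a1 : a < 1).
Let k_gt0 : (0 < k)%N := ltnW k_gt1.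

Definition alpha_maximizer (y : 'I_n -> R) := [/\ forall i, 0 <= y i,
  \sum_i y i ^+ k = 1 & forall z, (forall i, 0 <= z i) -> \sum_i z i ^+ k = 1 ->
    alpha_form k E a z <= alpha_form k E a y].

(** Both sides are homogeneous of degree [k], so a nonzero [z] can be scaled to satisfy the
    constraint. Free of the constraint, coordinates may be varied one at a time. *)
Lemma alpha_maximizer_homo y z : alpha_maximizer y -> (forall i, 0 <= z i) ->
  alpha_form k E a z <= alpha_form k E a y * \sum_i z i ^+ k.
Proof.
move=> [y0 y1 ymax] z0; set N := \sum_i z i ^+ k.
have N0 : 0 <= N by apply: sumr_ge0 => i _; rewrite exprn_ge0.
have [r r0 rN] := ex_nneg_root k_gt0 N0.
have [r_eq0|rn0] := eqVneq r 0.
  have z_eq0 i : z i = 0.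
    have /eqP := rN; rewrite r_eq0 expr0n gtn_eqF //= eq_sym psumr_eq0.
      by move=> /allP/(_ i (mem_index_enum _)); rewrite expf_eq0 k_gt0 /= => /eqP.
    by move=> j _; rewrite exprn_ge0.
  have -> : N = 0 by rewrite -rN r_eq0 expr0n gtn_eqF.
  rewrite (@eq_alpha_form _ _ _ _ _ _ (fun i => 0 * z i)); last first.
    by move=> i; rewrite z_eq0 mulr0.
  by rewrite alpha_form_homo // expr0n gtn_eqF // mul0r mulr0.
have r_gt0 : 0 < r by rewrite lt_neqAle eq_sym rn0.
rewrite (@eq_alpha_form _ _ _ _ _ _ (fun i => r * (r^-1 * z i))); last first.
  by move=> i; rewrite mulVKf.
rewrite alpha_form_homo // rN mulrC ler_wpM2r //; apply: ymax.
  by move=> i; rewrite mulr_ge0 // invr_ge0.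
under eq_bigr do rewrite exprMn.
by rewrite -mulr_sumr -/N -rN exprVn mulVf // expf_neq0.
Qed.

(** When only coordinate [i] varies, the slack in [alpha_maximizer_homo] is [p.[s] - p.[y i]]. Hence
    [p] is minimal at [y i], and its derivative there is [k] times the difference of the two
    sides. *)
Lemma alpha_maximizer_eigen y : alpha_maximizer y -> forall i,
  a * (deg E i)%:R * y i ^+ k.-1 + (1 - a) * link_sum E y i =
  alpha_form k E a y * y i ^+ k.-1.
Proof.
move=> ymax i; have [y0 y1 _] := ymax; set mu := alpha_form k E a y.
pose A := mu - a * (deg E i)%:R; pose B := (1 - a) * link_sum E y i.
pose p : {poly R} := A *: 'X^k - (k%:R * B) *: 'X.
have pE s : p.[s] = A * s ^+ k - k%:R * B * s.
  by rewrite /p !hornerE.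
have pmin s : 0 <= s -> p.[y i] <= p.[s].
  move=> s0; have := @alpha_maximizer_homo y (fun j => if j == i then s else y j) ymax.
  rewrite alpha_form_update //.
  have -> : \sum_j (if j == i then s else y j) ^+ k = 1 - y i ^+ k + s ^+ k.
    rewrite [LHS](bigD1 i) //= eqxx -y1 [X in X - _](bigD1 i) //=.
    rewrite (eq_bigr (fun j => y j ^+ k)); last by move=> j /negPf->.
    by ring.
  move=> h; have {h} : alpha_form k E a y + a * (deg E i)%:R * (s ^+ k - y i ^+ k)
      + (1 - a) * k%:R * ((s - y i) * link_sum E y i)
      <= alpha_form k E a y * (1 - y i ^+ k + s ^+ k).
    by apply: h => j; case: ifP.
  rewrite -/mu !pE /A /B -subr_ge0 => h; rewrite -subr_ge0.
  by congr (0 <= _): h; ring.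
have p'E : p^`().[y i] = k%:R * (A * y i ^+ k.-1 - B).
  by rewrite /p !derivE !hornerE /= hornerMn hornerXn -[_ ^+ _ *+ _]mulr_natl /B; ring.
have [] := deriv_half_line_min (y0 i) pmin.
rewrite p'E => ge0 eq0.
suff /eqP : A * y i ^+ k.-1 - B = 0.
  by rewrite subr_eq0 /A mulrBl subr_eq => /eqP->; rewrite addrC.
(* At a zero coordinate the derivative is only known to be nonnegative, which gives [B <= 0]; as [B]
   is built from nonnegative terms, it vanishes. *)
have [yi0|] := eqVneq (y i) 0; last first.
  move=> yn0; have /eq0/eqP : 0 < y i by rewrite lt_neqAle eq_sym yn0 y0.
  by rewrite mulf_eq0 pnatr_eq0 gtn_eqF //= => /eqP.
have k1 : (0 < k.-1)%N by rewrite -ltnS prednK.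
move: ge0; rewrite yi0 expr0n gtn_eqF //= mulr0 sub0r pmulr_rge0 ?ltr0n // oppr_ge0 => B0.
have B_ge0 : 0 <= B.
  rewrite mulr_ge0 ?subr_ge0 ?(ltW a1) //; apply: sumr_ge0 => e _.
  by apply: prodr_ge0 => w _.
by rewrite (le_anti (_ : B <= 0 <= B)) ?oppr0 // B0.
Qed.

Lemma alpha_maximizer_exists : (0 < n)%N -> exists y, alpha_maximizer y.
Proof.
move=> n_gt0; pose X (i : 'I_n) := GRing.Var R i.
pose P := GRing.Add
  (\big[@GRing.Add R/GRing.Const 0]_i
     GRing.Mul (GRing.Const (a * (deg E i)%:R)) (GRing.Exp (X i) k))
  (GRing.Mul (GRing.Const ((1 - a) * k%:R))
     (\big[@GRing.Add R/GRing.Const 0]_(e in E)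
        \big[@GRing.Mul R/GRing.Const 1]_(w in e) X w)).
pose G := GRing.Add (\big[@GRing.Add R/GRing.Const 0]_i GRing.Exp (X i) k) (GRing.Const (-1)).
have evalD e := @big_morph _ _ (GRing.eval e) 0 +%R (GRing.Const 0) (@GRing.Add R)
  (fun _ _ => erefl) erefl.
have evalM e := @big_morph _ _ (GRing.eval e) 1 *%R (GRing.Const 1) (@GRing.Mul R)
  (fun _ _ => erefl) erefl.
have rtermD (I : finType) (Q : pred I) (F : I -> GRing.term R) :
    (forall i, GRing.rterm (F i)) ->
    GRing.rterm (\big[@GRing.Add R/GRing.Const 0]_(i | Q i) F i).
  by move=> rF; apply: (big_ind (@GRing.rterm R)) => //= t1 t2 -> ->.
have PE (e : seq R) : GRing.eval e P = alpha_form k E a (fun i => e`_i).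
  rewrite /= !evalD; congr (_ + _ * _).
  by apply: eq_bigr => A _; rewrite evalM.
have GE (e : seq R) : GRing.eval e G = \sum_(i < n) e`_i ^+ k - 1.
  by rewrite /= evalD.
have rP : GRing.rterm P.
  rewrite /= !rtermD // => A.
  by apply: (big_ind (@GRing.rterm R)) => //= t1 t2 -> ->.
have rG : GRing.rterm G by rewrite /= rtermD.
have lP : local n (fun e => GRing.eval e P).
  by move=> e e' agr; rewrite !PE; apply: eq_alpha_form => i; apply: agr.
have lG : local n (fun e => GRing.eval e G).
  by move=> e e' agr; rewrite !GE; congr (_ - _); apply: eq_bigr => i _; rewrite agr.
have [|y [yc yG ymax]] := polynomial_max rP rG lP lG.
  (* The first unit vector is feasible: entries past the end of the list read 0. *)
  exists [:: 1] => [i _|]; first by case: i => [|[|i]] /=; rewrite ?ler01 ?lexx.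
  rewrite GE (bigD1 (Ordinal n_gt0)) //= expr1n big1 ?addr0 ?subrr // => -[[|i] lti] // _.
  by rewrite /= nth_nil expr0n gtn_eqF.
exists (fun i => y`_i); split=> [i||z z0 z1].
- by have /andP[] := yc i (ltn_ord i).
- by move/eqP: yG; rewrite GE subr_eq0 => /eqP.
pose e := [seq z i | i <- enum 'I_n].
have eE (i : 'I_n) : e`_i = z i by rewrite (nth_map i) ?size_enum_ord // nth_ord_enum.
have := ymax e; rewrite GE !PE (@eq_alpha_form _ _ _ _ _ _ z) //; apply.
  move=> i lti; rewrite (eE (Ordinal lti)) z0 /= -(@expr_le1 _ k) //.
  rewrite -z1 (bigD1 (Ordinal lti)) //= lerDl; apply: sumr_ge0 => j _.
  by rewrite exprn_ge0.
by under eq_bigr do rewrite eE; rewrite z1 subrr.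
Qed.

End Maximizer.

(** * Effect of the edge switch on degrees, form and link sums *)

Section EdgeSwitch.
Variables (n k : nat) (E : {set {set 'I_n}}) (e f U V : {set 'I_n}).
Hypotheses (eE : e \in E) (fE : f \in E) (ef0 : e :&: f = set0).
Hypotheses (Ue : U \subset e) (Vf : V \subset f) (cUV : #|U| = #|V|).
Hypotheses (U_gt0 : (0 < #|U|)%N) (unifE : @uniform n k E).
Hypotheses (e'E : U :|: (f :\: V) \notin E) (f'E : V :|: (e :\: U) \notin E).

Local Notation e' := (U :|: (f :\: V)).
Local Notation f' := (V :|: (e :\: U)).
Local Notation E' := (((E :\ e) :\ f) :|: [set e'; f']).

Let efN i : i \in e -> i \in f -> False.
Proof. by move=> ie jf; have := in_set0 i; rewrite -ef0 inE ie jf. Qed.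

Let disjUf : [disjoint U & f :\: V].
Proof.
rewrite disjoint_subset; apply/subsetP => i /(subsetP Ue) ie.
by rewrite !inE; apply/negP => /andP[_ /(efN ie)].
Qed.

Let disjVe : [disjoint V & e :\: U].
Proof.
rewrite disjoint_subset; apply/subsetP => i /(subsetP Vf) jf.
by rewrite !inE; apply/negP => /andP[_ /efN /(_ jf)].
Qed.

Let neq_ef : e != f.
Proof.
have [u uU] := card_gt0P U_gt0; have ue := subsetP Ue _ uU.
by apply/eqP => eqef; apply: (efN ue); rewrite -eqef.
Qed.

Let neq_e'f' : e' != f'.
Proof.
have [u uU] := card_gt0P U_gt0; have ue := subsetP Ue _ uU.
apply/eqP => /setP/(_ u); rewrite !inE uU /= orbF => /esym /(subsetP Vf).
exact: efN.
Qed.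

(** Stated without subtraction, so that it serves for degrees in [nat] as well as for edge monomials
    in [C]. *)
Lemma big_edge_switch (M : nmodType) (F : {set 'I_n} -> M) :
  \sum_(A in E') F A + (F e + F f) = \sum_(A in E) F A + (F e' + F f').
Proof.
rewrite [in RHS](big_setD1 e) //= [in RHS](big_setD1 f) /=; last first.
  by rewrite !inE eq_sym neq_ef.
rewrite [E :\ e :\ f :|: _]setUC -setUA !big_setU1 /=; last 2 first.
- by rewrite !inE (negPf f'E) !andbF.
- by rewrite !inE (negPf neq_e'f') (negPf e'E) !andbF.
rewrite (addrA (F e')) (addrA (F e)) -(addrA (F e' + F f')) [RHS]addrC; congr (_ + _).
exact: addrC.
Qed.

(** Both pairs of edges partition the same set [e :|: f]; this is why degrees are preserved. *)
Lemma mem_edge_switch i : ((i \in e) + (i \in f) = (i \in e') + (i \in f'))%N.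
Proof.
rewrite !inE; have [ie|ie] := boolP (i \in e).
  have [jf|jf] := boolP (i \in f); first by case: (efN ie jf).
  have /negPf-> : i \notin V by apply: contra jf; apply: (subsetP Vf).
  by rewrite andbF orbF andbT; case: (i \in U).
have /negPf-> : i \notin U by apply: contra ie; apply: (subsetP Ue).
have [jf|jf] := boolP (i \in f); first by case: (i \in V).
by have /negPf-> : i \notin V by apply: contra jf; apply: (subsetP Vf).
Qed.

Lemma deg_edge_switch i : deg E' i = deg E i.
Proof.
have degE (A : {set {set 'I_n}}) : deg A i = (\sum_(B in A) (i \in B))%N.
  rewrite /deg -sum1dep_card [LHS]big_mkcondr /=; apply: eq_bigr => B _; by case: (i \in B).
apply/eqP; rewrite -(eqn_add2r ((i \in e) + (i \in f))%N) {2}mem_edge_switch !degE.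
exact/eqP/big_edge_switch.
Qed.

Lemma uniform_edge_switch : @uniform n k E'.
Proof.
have ek := unifE eE; have fk := unifE fE.
move=> A; rewrite !inE => /orP[/andP[_ /andP[_ /unifE]]//|/orP[]/eqP->].
  rewrite cardsU disjoint_setI0 // cards0 subn0 cardsD (setIidPr Vf) cUV subnKC //.
  by rewrite subset_leq_card.
rewrite cardsU disjoint_setI0 // cards0 subn0 cardsD (setIidPr Ue) -cUV subnKC //.
by rewrite subset_leq_card.
Qed.

Section Values.
Variables (C : numClosedFieldType) (x : 'I_n -> C).

Lemma xprodE : [/\ xprod x e = xprod x U * xprod x (e :\: U),
  xprod x f = xprod x V * xprod x (f :\: V),
  xprod x e' = xprod x U * xprod x (f :\: V) &
  xprod x f' = xprod x V * xprod x (e :\: U)].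
Proof.
split; rewrite /xprod.
- by rewrite (big_setID U) /= (setIidPr Ue).
- by rewrite (big_setID V) /= (setIidPr Vf).
- by rewrite -bigU ?disjUf //; apply: eq_bigl => i; rewrite !inE.
- by rewrite -bigU ?disjVe //; apply: eq_bigl => i; rewrite !inE.
Qed.

(** Degrees being equal, only four edge monomials matter, and [x_U x_(f - V) + x_V x_(e - U) - x_U
    x_(e - U) - x_V x_(f - V)] factors. *)
Lemma alpha_form_edge_switch a : alpha_form k E' a x = alpha_form k E a x +
  (1 - a) * k%:R * ((xprod x U - xprod x V) * (xprod x (f :\: V) - xprod x (e :\: U))).
Proof.
have [xe xf xe' xf'] := xprodE; have sw := big_edge_switch (xprod x).
rewrite /alpha_form; under eq_bigr do rewrite deg_edge_switch.
rewrite -addrA -mulrDr; congr (_ + _ * _).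
have -> : \sum_(A in E') \prod_(w in A) x w =
    \sum_(A in E) xprod x A + (xprod x e' + xprod x f') - (xprod x e + xprod x f).
  by rewrite -sw addrK.
by rewrite xe xf xe' xf' -!addrA; congr (_ + _); ring.
Qed.

(** The factor [x i] completes the link terms to full edge monomials, to which [big_edge_switch]
    applies. *)
Lemma link_sum_edge_switch i : x i * link_sum E' x i + ((i \in e)%:R * xprod x e + (i \in f)%:R * xprod x f)
  = x i * link_sum E x i + ((i \in e')%:R * xprod x e' + (i \in f')%:R * xprod x f').
Proof.
have LE (A : {set {set 'I_n}}) : x i * link_sum A x i = \sum_(B in A) (i \in B)%:R * xprod x B.
  rewrite link_sum_mul big_mkcondr; apply: eq_bigr => B _.
  by case: (i \in B); rewrite ?mul1r ?mul0r.
rewrite !LE; exact: (big_edge_switch (fun A => (i \in A)%:R * xprod x A)).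
Qed.

End Values.
End EdgeSwitch.

(** * Strict comparison of the two spectral radii *)

Theorem theorem4p2 (C : numClosedFieldType) (n k : nat) (a : C)
  (E : {set {set 'I_n}}) (e f U V : {set 'I_n}) (x : 'I_n -> C) (rho rho' : C) :
  (2 <= k)%N -> 0 <= a -> a < 1 ->
  @uniform n k E -> connected E ->
  (* rho = rho_alpha(G), x its alpha-Perron vector *)
  is_specrad (@AalphaT C n k a E) rho ->
  (forall i, 0 < x i) -> \sum_i x i ^+ k = 1 ->
  (forall i, tapp (@AalphaT C n k a E) x i = rho * x i ^+ k.-1) ->
  e \in E -> f \in E -> e :&: f = set0 ->
  U \subset e -> V \subset f -> #|U| = #|V| -> (1 <= #|U| <= k.-1)%N ->
  U :|: (f :\: V) \notin E -> V :|: (e :\: U) \notin E ->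
  (* rho' = rho_alpha(G'), G' = G - e - f + e' + f' *)
  is_specrad (@AalphaT C n k a (((E :\ e) :\ f) :|: [set U :|: (f :\: V); V :|: (e :\: U)])) rho' ->
  xprod x V <= xprod x U -> xprod x (e :\: U) <= xprod x (f :\: V) ->
  (xprod x V < xprod x U) || (xprod x (e :\: U) < xprod x (f :\: V)) ->
  rho < rho'.
Proof.
move=> k_gt1 a0 a1 unifE _ [[l [_ lrho]] _] x0 x1 xeig eE fE ef0 Ue Vf cUV.
move=> /andP[U_gt0 Uk] e'E f'E [[l' [_ lrho']] rho'max] leUV leW strict.
have k_gt0 := ltnW k_gt1.
have sw_unif := uniform_edge_switch eE fE ef0 Ue Vf cUV unifE.
have sw_form := alpha_form_edge_switch k eE fE ef0 Ue Vf U_gt0 e'E f'E x a.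
have sw_deg := deg_edge_switch eE fE ef0 Ue Vf U_gt0 e'E f'E.
have sw_link := link_sum_edge_switch eE fE ef0 Ue Vf U_gt0 e'E f'E x.
have [xe xf xe' xf'] := xprodE ef0 Ue Vf x.
set E' := (_ :|: [set _; _]) in rho'max sw_unif sw_form sw_deg sw_link *.
(* The data are real, so they lift to [realpart C], where a maximizer exists. *)
pose ar : realpart C := RealPart (ger0_real a0).
have ar1 : ar < 1 by exact: a1.
pose xr i : realpart C := RealPart (gtr0_real (x0 i)).
have [u uU] := card_gt0P U_gt0.
have n_gt0 : (0 < n)%N := leq_ltn_trans (leq0n u) (ltn_ord u).
have formC (z : 'I_n -> realpart C) :
    cval (alpha_form k E' ar z) = alpha_form k E' a (cval \o z).
  exact: rmorph_alpha_form.
have eigC (z : 'I_n -> realpart C) i : alpha_maximizer k E' ar z ->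
    a * (deg E' i)%:R * cval (z i) ^+ k.-1 + (1 - a) * link_sum E' (cval \o z) i =
    alpha_form k E' a (cval \o z) * cval (z i) ^+ k.-1.
  move=> zmax; rewrite -formC.
  have := congr1 cval (alpha_maximizer_eigen k_gt1 sw_unif ar1 zmax i).
  by rewrite rmorphD !rmorphM rmorphB rmorph1 rmorph_nat !rmorphXn rmorph_link_sum.
have [y ymax] := alpha_maximizer_exists E' ar k_gt1 n_gt0.
pose mu := alpha_form k E' ar y; have [y0 y1 ymax_le] := ymax.
have mu_le : `|cval mu| <= rho'.
  apply: rho'max; exists (cval \o y); split.
    apply/existsP; rewrite -negb_forall; apply/negP => /forallP y_eq0.
    move: (oner_neq0 (realpart C)); rewrite -y1 big1 ?eqxx // => i _.
    have /eqP yi0 := y_eq0 i.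
    by rewrite (_ : y i = 0) ?expr0n ?gtn_eqF //; apply: cval_inj.
  by move=> i; rewrite tapp_AalphaT // eigC // formC.
have rhoE : rho = alpha_form k E a x.
  rewrite alpha_form_sum //; under eq_bigr do rewrite -tapp_AalphaT // xeig mulrCA -exprS prednK //.
  by rewrite -mulr_sumr x1 mulr1.
have gap_ge0 : alpha_form k E a x <= alpha_form k E' a x.
  by rewrite sw_form lerDl !mulr_ge0 ?subr_ge0 // ltW.
have xr0 i : 0 <= xr i by rewrite ler_cval /= ltW.
have xr1 : \sum_i xr i ^+ k = 1.
  by apply: cval_inj; rewrite rmorph_sum /= -[RHS]x1; apply: eq_bigr => i _; rewrite rmorphXn.
have le_mu : alpha_form k E' a x <= cval mu.
  by have := ymax_le xr xr0 xr1; rewrite ler_cval formC.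
(* Both radii are moduli, hence real and comparable. *)
rewrite real_ltNge -?lrho -?lrho' ?normr_real // lrho lrho'; apply/negP => le_rho.
have mu_le_rho : cval mu <= rho.
  by apply: le_trans (le_trans mu_le le_rho); apply: real_ler_norm; apply: cvalP.
have formE : alpha_form k E' a x = rho.
  by apply/le_anti; rewrite (le_trans le_mu mu_le_rho) rhoE gap_ge0.
have xrmax : alpha_maximizer k E' ar xr.
  split=> // z z0 z1; apply: le_trans (ymax_le z z0 z1) _.
  by rewrite ler_cval [X in _ <= X]formC; apply: le_trans mu_le_rho _; rewrite -formE.
have a1_neq0 : 1 - a != 0 by rewrite subr_eq0 eq_sym lt_eqF.
(* The two eigenvalue equations share [rho] and the degrees, so their link terms agree after
   cancelling [1 - a]. *)
have linkE i : link_sum E' x i = link_sum E x i.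
  have : a * (deg E' i)%:R * x i ^+ k.-1 + (1 - a) * link_sum E' x i = rho * x i ^+ k.-1.
    by rewrite -formE; exact: (eigC xr i xrmax).
  by rewrite -xeig tapp_AalphaT // sw_deg => /addrI /(mulfI a1_neq0).
have xprod_neq0 S : xprod x S != 0 by rewrite gt_eqF // prodr_gt0.
have efN i : i \in e -> (i \in f) = false.
  by move=> ie; have := in_set0 i; rewrite -ef0 inE ie.
(* Among the four switched edges, [u] lies in [e] and [e'] only, so these have equal products; the
   common factor over [U] cancels. *)
have eqW : xprod x (e :\: U) = xprod x (f :\: V).
  have ue := subsetP Ue _ uU; have uV : (u \in V) = false.
    by apply: contraFF (efN u ue); apply: (subsetP Vf).
  apply: (mulfI (xprod_neq0 U)); rewrite -xe -xe'.
  have := sw_link u; rewrite linkE => /addrI.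
  by rewrite !inE uU ue uV efN // !(mul1r, mul0r, addr0).
have eqU : xprod x U = xprod x V.
  (* The bound [#|U| <= k.-1] provides [w] in [e] outside [U]; it lies in [e] and [f'] only. *)
  have /card_gt0P[w] : (0 < #|e :\: U|)%N.
    by rewrite cardsD (setIidPr Ue) (unifE _ eE) subn_gt0 -(prednK k_gt0) ltnS.
  rewrite inE => /andP[/negPf wU we]; have wV : (w \in V) = false.
    by apply: contraFF (efN w we); apply: (subsetP Vf).
  apply: (mulIf (xprod_neq0 (e :\: U))); rewrite -xe -xf'.
  have := sw_link w; rewrite linkE => /addrI.
  by rewrite !inE wU we wV efN // !(mul1r, mul0r, addr0, add0r).
by move: strict; rewrite eqU eqW !ltxx.
Qed.
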